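(* For every integer $d\ge 3$ there exists $D_0(d)$ such that for all integers $D\ge D_0(d)$ and every edge $e$ of the Kautz digraph $K(d,D)$ whose edge-word is a circular square-free ternary word of length $D+1$ (over $\{0,1,2\}$, viewed inside the alphabet $[d+1]$), we have \[ \mathrm{cong}(e)\ >\ \tau(d,D),\qquad\text{where }\tau(d,D)=(D-1)d^{D-2}+D\,d^{D-1}. \]
   Context: Write $[n]=\{0,1,\dots,n-1\}$. The Kautz digraph $K(d,D)$ has as vertices all words $x_0\cdots x_{D-1}$ of length $D$ over $[d+1]$ with $x_i\ne x_{i+1}$ for all $i$, and directed edges $x_0x_1\cdots x_{D-1}\to x_1\cdots x_{D-1}x_D$ for $x_D\in[d+1]\setminus\{x_{D-1}\}$. Every ordered pair of distinct vertices is joined by a unique shortest directed path (geodesic). An edge $e:u\to v$ with $u=a_0\cdots a_{D-1}$, $v=a_1\cdots a_D$ has edge-word $a_0a_1\cdots a_D$. For an edge $e$, $\mathrm{cong}(e)$ is the number of ordered pairs $(x,y)$ of distinct vertices whose unique geodesic from $x$ to $y$ uses $e$. A word is square-free if it has no contiguous subword $XX$ with $X$ nonempty; it is circular square-free if every cyclic rotation of it is square-free. *)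

(* Defs.v *)
From mathcomp Require Import all_boot.
From mathcomp Require Import boolp.

Set Implicit Arguments.
Unset Strict Implicit.
Unset Printing Implicit Defensive.

Section Geodesics.

Variables (V : finType) (e : rel V).

(* As in [path], the walk [x :: p] is given by its source and its tail. *)
Definition geodesic (x y : V) (p : seq V) : Prop :=
  [/\ path e x p, last x p = y &
      forall q : seq V, path e x q -> last x q = y -> size p <= size q].

(* In the Kautz digraph geodesics are unique, so the existential below speaks
   about the geodesic from [x] to [y]. *)
Definition geodesic_uses (u v x y : V) : Prop :=
  exists2 p : seq V, geodesic x y p & infix [:: u; v] (x :: p).

Definition cong (u v : V) : nat :=
  #|[set xy : V * V | (xy.1 != xy.2) && `[< geodesic_uses u v xy.1 xy.2 >]]|.

End Geodesics.

Section SquareFree.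

Variable T : eqType.

Definition square_free (w : seq T) : Prop :=
  forall X : seq T, X != [::] -> ~~ infix (X ++ X) w.

Definition circular_square_free (w : seq T) : Prop :=
  forall k : nat, square_free (rot k w).

End SquareFree.

Definition kautz (d D : nat) : Type :=
  {x : D.-tuple 'I_d.+1 | sorted (fun a b => a != b) x}.

Definition word (d D : nat) (x : kautz d D) : seq 'I_d.+1 := val (val x).

(* The condition on [c] is implied by [y] being a vertex, except when D = 1,
   where it excludes loops. The default [ord0] of [last] is irrelevant for
   D >= 1, and there is no edge when D = 0. *)
Definition kautz_edge (d D : nat) : rel (kautz d D) := fun x y =>
  [exists c : 'I_d.+1,
     (c != last ord0 (word x)) && (word y == rcons (behead (word x)) c)].

Definition edge_word (d D : nat) (u v : kautz d D) : seq 'I_d.+1 :=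
  rcons (word u) (last ord0 (word v)).

Definition ternary (d : nat) (w : seq 'I_d.+1) : bool :=
  all (fun a : 'I_d.+1 => a < 3) w.

Definition tau (d D : nat) : nat := (D - 1) * d ^ (D - 2) + D * d ^ (D - 1).

(* Main.v *)
Require Import Defs.
From mathcomp Require Import all_boot zify.
From mathcomp Require Import boolp.

(* Let W be the edge-word and k <= D.  Walks of length k with e in position i
   correspond to words z = PWQ with |P| = i and |Q| = k - 1 - i; there are
   k d^(k-1) of them.  Such a walk from x to y fails to be geodesic only if z
   contains a square of some half-length p <= k centred at position k (a suffix
   of x longer than D - k is then a prefix of y).  The centre cuts W into a
   prefix of length n = k - i and a suffix of length m.  If p <= n and p <= m
   the square lies in W; if p > n and p > m, then p is a period of W and some
   rotation of W contains a square.  Otherwise, say n < p <= m, the prefix of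
   length n reappears in W after a gap g = p - n and the last g letters of P
   are forced, which leaves d^(k-1-g) words.  For a fixed g, two such n < n'
   satisfy n' > 2n because W is square-free, so that there are O(log D) of them
   and only O(log D) d^(k-1) walks are lost.  For D large, the lengths D, D-1
   and D-2 together give more than tau(d, D), the surplus being of order
   (D - 2) d^(D-3). *)

Set Implicit Arguments.
Unset Strict Implicit.
Unset Printing Implicit Defensive.

(** * Squares and periods of circular square-free words *)

Section Words.

Variables (T : eqType) (x0 : T).
Implicit Types w : seq T.

Lemma square_free_nth w a q : square_free w -> 0 < q -> a + q + q <= size w ->
  ~ (forall t, t < q -> nth x0 w (a + t) = nth x0 w (a + q + t)).
Proof.
move=> sf q0 le_w eq_w; set X := take q (drop a w).
have sX : size X = q by rewrite size_takel // size_drop; lia.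
have XX : X = take q (drop (a + q) w).
  apply: (@eq_from_nth _ x0); first by rewrite sX size_takel // size_drop; lia.
  by move=> t; rewrite sX => lt_t; rewrite !nth_take // !nth_drop eq_w.
have /negP[] : ~~ infix (X ++ X) w.
  by apply: sf; rewrite -size_eq0 sX -lt0n.
have -> : X ++ X = take (q + q) (drop a w).
  by rewrite takeD drop_drop [q + a]addnC -XX.
by apply/infixP; exists (take a w), (drop (q + q) (drop a w)); rewrite !cat_take_drop.
Qed.

(** A period p of at most half the length makes the prefix of length 2p a square. For larger p, the
    suffix of length [size w - p] equals the prefix of that length, and the rotation by p puts them
    side by side. *)
Lemma circular_square_free_aperiodic w p : circular_square_free w ->
    0 < p < size w ->
  ~ (forall t, p + t < size w -> nth x0 w t = nth x0 w (p + t)).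
Proof.
move=> csf /andP[p0 ltp] per.
case: (leqP (p + p) (size w)) => [le2p|lt2p].
  have := csf 0; rewrite rot0 => sf.
  by apply: (@square_free_nth w 0 p sf p0) => // t lt_t; rewrite !add0n per //; lia.
apply: (@square_free_nth (rot p w) 0 (size w - p) (csf p)); rewrite ?size_rot; try lia.
move=> t lt_t; rewrite !add0n /rot !nth_cat size_drop lt_t ifN; last by rewrite -leqNgt leq_addr.
have lt_tp : t < p by lia.
have lt_w : p + t < size w by lia.
by rewrite nth_drop addKn (nth_take _ lt_tp) [RHS]per.
Qed.

End Words.

(** * Coding Kautz continuations by free letters *)

Section Walks.

Variable d : nat.

(** [lift a] enumerates the d letters other than [a], so arbitrary sequences over ['I_d] code the
    words that may follow [a]. *)
Fixpoint walk_from (a : 'I_d.+1) (s : seq 'I_d) : seq 'I_d.+1 :=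
  if s is c :: s' then lift a c :: walk_from (lift a c) s' else [::].

Lemma size_walk_from a s : size (walk_from a s) = size s.
Proof. by elim: s a => //= c s IH a; rewrite IH. Qed.

Lemma path_walk_from a s : path (fun b c => b != c) a (walk_from a s).
Proof. by elim: s a => //= c s IH a; rewrite neq_lift IH. Qed.

Lemma take_walk_from g a s : take g (walk_from a s) = walk_from a (take g s).
Proof. by elim: s g a => [|c s IH] [|g] a //=; rewrite IH. Qed.

Lemma walk_from_inj a : injective (walk_from a).
Proof.
move=> s s'; elim: s s' a => [|c s IH] [|c' s'] a //= /eqP.
rewrite eqseq_cons => /andP[/eqP/lift_inj-> /eqP/IH->] //.
Qed.

End Walks.

(** * Counting tools *)

Lemma card_fixed_window (A : finType) n i g (B : {set n.-tuple A}) :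
    i + g <= n ->
    {in B &, forall t t' : n.-tuple A, take g (drop i t) = take g (drop i t')} ->
  #|B| <= #|A| ^ (n - g).
Proof.
move=> le_n fixB.
(* Deleting the common window is injective on [B]. *)
pose f (t : n.-tuple A) := take i t ++ drop (i + g) t.
have sf t : size (f t) == n - g.
  by rewrite size_cat size_takel ?size_drop size_tuple //; lia.
rewrite -card_tuple -(@card_in_imset _ _ (fun t => Tuple (sf t)) B) ?max_card //.
move=> t t' Bt Bt' [] /eqP; rewrite /f eqseq_cat; last first.
  by rewrite !size_takel // size_tuple; lia.
case/andP=> /eqP e1 /eqP e2; apply: val_inj => /=.
rewrite -(cat_take_drop i t) -(cat_take_drop i t') e1; congr (_ ++ _).
rewrite -(cat_take_drop g (drop i t)) -(cat_take_drop g (drop i t')).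
by rewrite !drop_drop (addnC g) e2 (fixB t t').
Qed.

(** The rounded binary logarithm of [h] is injective on these indices: two values with the same one
    differ by a factor below 2. *)
Lemma card_doubling_gaps k N (b : pred nat) (h : nat -> nat) : {in gtn k &, injective h} ->
    (forall i, i < k -> 0 < h i <= N) ->
    (forall i i', i < k -> i' < k -> b i -> b i' -> h i < h i' -> (h i).*2 < h i') ->
  #|[set i : 'I_k | b i]| <= (trunc_log 2 N).+1.
Proof.
move=> hI hN gap.
pose f (i : 'I_k) : 'I_(trunc_log 2 N).+1 := inord (trunc_log 2 (h i)).
rewrite -[leqRHS]card_ord -(@card_in_imset _ _ f) ?max_card //.
have lt_gap (i i' : 'I_k) : b i -> b i' -> trunc_log 2 (h i) = trunc_log 2 (h i') ->
    ~ h i < h i'.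
  move=> bi bi' e lt_h; have := gap i i' (ltn_ord i) (ltn_ord i') bi bi' lt_h.
  have /andP[hi0 _] := hN i (ltn_ord i).
  have /andP[le_l _] := trunc_log_bounds (ltnSn 1) hi0.
  have /andP[hi'0 _] := hN i' (ltn_ord i').
  have /andP[_] := trunc_log_bounds (ltnSn 1) hi'0.
  by rewrite -e expnS; lia.
have lt_log (i : 'I_k) : trunc_log 2 (h i) < (trunc_log 2 N).+1.
  by rewrite ltnS; apply: leq_trunc_log; case/andP: (hN i (ltn_ord i)).
move=> i i'; rewrite !inE => bi bi' /(congr1 val); rewrite /= !inordK ?lt_log // => e.
apply: val_inj; apply: hI; rewrite ?inE ?ltn_ord //.
by case: (ltngtP (h i) (h i')) => [/(lt_gap _ _ bi bi' e)|/(lt_gap _ _ bi' bi (esym e))|].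
Qed.

Lemma leq_card_bigcup (T : finType) n (F : 'I_n -> {set T}) :
  #|\bigcup_(i < n) F i| <= \sum_(i < n) #|F i|.
Proof.
elim/big_rec2: _ => [|i m A _ le_m]; first by rewrite cards0.
by apply: leq_trans (leq_add (leqnn _) le_m); rewrite cardsU leq_subr.
Qed.

Lemma sum_expn_leq d m : 1 < d -> \sum_(g < m) d ^ (m - g.+1) <= d ^ m.
Proof.
move=> d1; elim: m => [|m IH]; first by rewrite big_ord0.
rewrite big_ord_recl subn1 /= expnS.
apply: (@leq_trans (2 * d ^ m)); last by rewrite leq_mul2r d1 orbT.
by rewrite mul2n -addnn leq_add2l.
Qed.

(** * Recurring prefixes and suffixes of a square-free word *)

Section Recurrences.

Variables (T : eqType) (x0 : T) (w : seq T).

Definition prefix_recurs n g :=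
  (n + g + n <= size w) &&
  [forall s : 'I_n, nth x0 w s == nth x0 w (n + g + s)].

Definition suffix_recurs n g :=
  (n + g + n <= size w) &&
  [forall s : 'I_n, nth x0 w (size w - (n + g + n) + s) == nth x0 w (size w - n + s)].

Hypothesis sfw : square_free w.

(** If n < n' <= 2n, the later occurrences start at n + g and n' + g, so the first n' - n letters of
    [w] appear twice in a row from n + g on. *)
Lemma prefix_recurs_doubling g n n' :
  prefix_recurs n g -> prefix_recurs n' g -> n < n' -> n.*2 < n'.
Proof.
case/andP=> le_n /forallP eq_n /andP[le_n' /forallP eq_n'] lt_n.
rewrite ltnNge; apply/negP => le_n2.
apply: (@square_free_nth _ x0 w (n + g) (n' - n) sfw); try lia.
move=> t lt_t; have lt_tn : t < n by lia.
have lt_tn' : t < n' by lia.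
have /eqP /= <- := eq_n (Ordinal lt_tn).
have /eqP /= -> := eq_n' (Ordinal lt_tn').
by congr nth; lia.
Qed.

Lemma suffix_recurs_doubling g n n' :
  suffix_recurs n g -> suffix_recurs n' g -> n < n' -> n.*2 < n'.
Proof.
case/andP=> le_n /forallP eq_n /andP[le_n' /forallP eq_n'] lt_n.
rewrite ltnNge; apply/negP => le_n2.
(* Both halves of this square copy the first n' - n letters of the suffix of length n. *)
apply: (@square_free_nth _ x0 w (size w - (n' + g + n)) (n' - n) sfw); try lia.
move=> t lt_t; have lt_tn : t < n by lia.
have lt_tn' : n' - n + t < n' by lia.
have /eqP /= e := eq_n (Ordinal lt_tn).
have /eqP /= e' := eq_n' (Ordinal lt_tn').
have -> : size w - (n' + g + n) + t = size w - (n' + g + n') + (n' - n + t) by lia.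
have -> : size w - (n' + g + n) + (n' - n) + t = size w - (n + g + n) + t by lia.
by rewrite e e'; congr nth; lia.
Qed.

End Recurrences.

(** * Central squares in the extensions of an edge-word *)

Definition central_square (T : eqType) (x0 : T) k p (z : seq T) :=
  [forall s : 'I_p, nth x0 z (k - p + s) == nth x0 z (k + s)].

(** Half-lengths stop at k because a rival walk of length j < k produces the half-length k - j. *)
Definition no_central_square (T : eqType) (x0 : T) k (z : seq T) :=
  [forall p : 'I_k, ~~ central_square x0 k p.+1 z].

Section Extensions.

Variables (d : nat) (W : seq 'I_d.+1).

(** One sequence [t] carries both free parts: its first i entries code P, generated leftwards from
    [W] and hence reversed; the others code Q. *)
Definition extension i (t : seq 'I_d) : seq 'I_d.+1 :=
  rev (walk_from (head ord0 W) (take i t)) ++ W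
  ++ walk_from (last ord0 W) (drop i t).

Local Notation nth0 := (nth (ord0 : 'I_d.+1)).

Lemma size_extension i t : size (extension i t) = size W + size t.
Proof.
rewrite !size_cat size_rev !size_walk_from -[in RHS](cat_take_drop i t) size_cat.
lia.
Qed.

Lemma nth_extension_mid i t s : i <= size t -> s < size W ->
  nth0 (extension i t) (i + s) = nth0 W s.
Proof.
move=> le_i lt_s; rewrite nth_cat size_rev size_walk_from size_takel //.
by rewrite ifN -?leqNgt ?leq_addr // addKn nth_cat lt_s.
Qed.

Lemma nth_extension_left i t s : i <= size t -> s < i ->
  nth0 (extension i t) (i - s.+1) = nth0 (walk_from (head ord0 W) (take i t)) s.
Proof.
move=> le_i lt_s; rewrite nth_cat size_rev size_walk_from size_takel //.
rewrite ifT; last by lia.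
rewrite nth_rev size_walk_from size_takel //; last by lia.
by congr nth; lia.
Qed.

Lemma nth_extension_right i t s : i <= size t ->
  nth0 (extension i t) (i + (size W + s)) = nth0 (walk_from (last ord0 W) (drop i t)) s.
Proof.
move=> le_i; rewrite nth_cat size_rev size_walk_from size_takel //.
by rewrite ifN -?leqNgt ?leq_addr // addKn nth_cat ifN -?leqNgt ?leq_addr // addKn.
Qed.

Variable k : nat.
Hypotheses (k0 : 0 < k) (ltkW : k < size W) (csfW : circular_square_free W).

Let sfW : square_free W.
Proof. by have := csfW 0; rewrite rot0. Qed.

Let square_free_W a q : 0 < q -> a + q + q <= size W ->
  ~ (forall t, t < q -> nth0 W (a + t) = nth0 W (a + q + t)).
Proof. exact: square_free_nth. Qed.

Let aperiodic_W p : 0 < p < size W ->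
  ~ (forall t, p + t < size W -> nth0 W t = nth0 W (p + t)).
Proof. exact: circular_square_free_aperiodic. Qed.

(** The centre lies k - i letters into [W]. The g letters after it fill the gap between the two
    occurrences of the prefix, and P must end with them; P is generated leftwards, hence the
    [rev]. *)
Definition left_forced i g (t : seq 'I_d) :=
  (g <= i) && (take g (walk_from (head ord0 W) (take i t)) == rev (take g (drop (k - i) W))).

(** Here the gap consists of the g letters of [W] just before the centre, and Q must begin with
    them. *)
Definition right_forced i g (t : seq 'I_d) :=
  (i + g <= k.-1) && (take g (walk_from (last ord0 W) (drop i t)) == take g (drop (k - i - g) W)).

Lemma central_square_forces i p t : size t = k.-1 -> i < k -> 0 < p <= k ->
    central_square ord0 k p (extension i t) ->
  exists2 g, 0 < g < k &
    prefix_recurs ord0 W (k - i) g && left_forced i g t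
    || suffix_recurs ord0 W (size W - (k - i)) g && right_forced i g t.
Proof.
move=> st lt_ik /andP[p0 le_pk] /forallP sq_z.
have le_i : i <= size t by lia.
(* The centre has n letters of [W] on its left and m on its right. *)
have [n En] : {n | n = k - i} by exists (k - i).
have [m Em] : {m | m = size W - n} by exists (size W - n).
have szW : size W = n + m by lia.
rewrite -En -Em.
have eq_z s : s < p -> nth0 (extension i t) (k - p + s) = nth0 (extension i t) (k + s).
  by move=> lt_s; apply/eqP; apply: (sq_z (Ordinal lt_s)).
have eq_W s : p <= n + s -> s < p -> s < m -> nth0 W (n + s - p) = nth0 W (n + s).
  move=> le_s lt_s lt_m; have := eq_z s lt_s.
  have -> : k - p + s = i + (n + s - p) by lia.
  have -> : k + s = i + (n + s) by lia.
  by rewrite !nth_extension_mid //; lia.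
case: (leqP p n) => [le_pn|lt_np]; case: (leqP p m) => [le_pm|lt_mp].
- case: (@square_free_W (n - p) p p0); first by lia.
  move=> s lt_s; have := eq_W s _ lt_s _.
  have -> : n + s - p = n - p + s by lia.
  have -> : n + s = n - p + p + s by lia.
  by apply; lia.
(* The right half of the square runs p - m letters past the end of [W]. *)
- exists (p - m); first by lia.
  apply/orP; right; apply/andP; split; apply/andP; split; rewrite ?szW; try lia.
    apply/forallP => -[s /= lt_s]; apply/eqP.
    have := eq_W s _ _ _.
    have -> : n + m - (m + (p - m) + m) + s = n + s - p by lia.
    have -> : n + m - m + s = n + s by lia.
    by apply; lia.
  have sl : size (take (p - m) (walk_from (last ord0 W) (drop i t))) = p - m.
    by rewrite size_takel // size_walk_from size_drop; lia.
  have sr : size (take (p - m) (drop (k - i - (p - m)) W)) = p - m.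
    by rewrite size_takel // size_drop; lia.
  apply/eqP; apply: (@eq_from_nth _ ord0); rewrite ?sl ?sr // => s lt_s.
  rewrite !nth_take // -nth_extension_right // nth_drop.
  have lt_sp : m + s < p by lia.
  have := eq_z (m + s) lt_sp.
  have -> : k - p + (m + s) = i + (k - i - (p - m) + s) by lia.
  have -> : k + (m + s) = i + (size W + s) by lia.
  by move=> <-; rewrite nth_extension_mid //; lia.
- exists (p - n); first by lia.
  apply/orP; left; apply/andP; split; apply/andP; split; rewrite ?szW; try lia.
    apply/forallP => -[s /= lt_s]; apply/eqP.
    have := eq_W (p - n + s) _ _ _.
    have -> : n + (p - n + s) - p = s by lia.
    have -> : n + (p - n) + s = n + (p - n + s) by lia.
    by apply; lia.
  have sl : size (take (p - n) (walk_from (head ord0 W) (take i t))) = p - n.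
    by rewrite size_takel // size_walk_from size_takel //; lia.
  have sr : size (take (p - n) (drop (k - i) W)) = p - n.
    by rewrite size_takel // size_drop; lia.
  apply/eqP; apply: (@eq_from_nth _ ord0); rewrite ?size_rev ?sl ?sr // => s lt_s.
  rewrite nth_rev ?sr // !nth_take //; last by lia.
  rewrite nth_drop -nth_extension_left //; last by lia.
  have lt_sp : p - n - s.+1 < p by lia.
  have := eq_z _ lt_sp.
  have -> : k - p + (p - n - s.+1) = i - s.+1 by lia.
  have -> : k + (p - n - s.+1) = i + (k - i + (p - n - s.+1)) by lia.
  by move=> ->; rewrite nth_extension_mid //; lia.
(* Both halves now stick out of [W], so the equalities inside [W] say that p is a period; it is
   proper since p <= k < [size W]. *)
case: (@aperiodic_W p); first by lia.
move=> s lt_s; have := eq_W (p + s - n) _ _ _.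
have -> : n + (p + s - n) - p = s by lia.
have -> : n + (p + s - n) = p + s by lia.
by apply; lia.
Qed.

(** As [walk_from] is injective, forced letters fix g consecutive entries of [t]: from entry 0 on
    the left side, from entry i on the right side. *)
Lemma card_left_forced i g : i < k ->
  #|[set t : k.-1.-tuple 'I_d | left_forced i g t]| <= d ^ (k.-1 - g).
Proof.
move=> lt_i; case: (leqP g i) => [le_g|lt_g]; last first.
  rewrite (_ : [set _ | _] = set0) ?cards0 //; apply/setP => t.
  by rewrite !inE /left_forced leqNgt lt_g.
rewrite -[X in X ^ _]card_ord; apply: (@card_fixed_window _ _ 0); first by lia.
move=> t t'; rewrite !inE => /andP[_ /eqP e] /andP[_ /eqP e'].
rewrite !drop0; move: e; rewrite -e' !take_walk_from => /walk_from_inj.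
by rewrite !take_takel.
Qed.

Lemma card_right_forced i g : i < k ->
  #|[set t : k.-1.-tuple 'I_d | right_forced i g t]| <= d ^ (k.-1 - g).
Proof.
move=> lt_i; case: (leqP (i + g) k.-1) => [le_g|lt_g]; last first.
  rewrite (_ : [set _ | _] = set0) ?cards0 //; apply/setP => t.
  by rewrite !inE /right_forced leqNgt lt_g.
rewrite -[X in X ^ _]card_ord; apply: (@card_fixed_window _ _ i) => //.
move=> t t'; rewrite !inE => /andP[_ /eqP e] /andP[_ /eqP e'].
by move: e; rewrite -e' !take_walk_from => /walk_from_inj.
Qed.

Lemma card_central_square i : i < k ->
  #|[set t : k.-1.-tuple 'I_d | ~~ no_central_square ord0 k (extension i t)]|
  <= \sum_(g < k.-1) (prefix_recurs ord0 W (k - i) g.+1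
                      + suffix_recurs ord0 W (size W - (k - i)) g.+1) * d ^ (k.-1 - g.+1).
Proof.
move=> lt_i.
pose B (g : 'I_k.-1) : {set k.-1.-tuple 'I_d} :=
  [set t : k.-1.-tuple 'I_d | prefix_recurs ord0 W (k - i) g.+1 && left_forced i g.+1 t]
  :|: [set t : k.-1.-tuple 'I_d |
        suffix_recurs ord0 W (size W - (k - i)) g.+1 && right_forced i g.+1 t].
apply: (@leq_trans #|\bigcup_(g < k.-1) B g|).
  apply/subset_leq_card/subsetP => t; rewrite inE negb_forall => /existsP[p].
  rewrite negbK => sq; have lt_p := ltn_ord p.
  have [//|//|//|g /andP[g0 lt_g] gP] := central_square_forces _ _ _ sq.
    by rewrite size_tuple.
  have lt_g1 : g.-1 < k.-1 by lia.
  apply/bigcupP; exists (Ordinal lt_g1) => //.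
  by rewrite !inE /= prednK.
apply: leq_trans (leq_card_bigcup _) _; apply: leq_sum => g _.
rewrite mulnDl /B.
set L := [set _ | _]; set R := [set _ | _].
apply: (@leq_trans (#|L| + #|R|)); first by rewrite cardsU leq_subr.
apply: leq_add; rewrite /L /R.
  case: prefix_recurs => /=; first by rewrite mul1n card_left_forced.
  by rewrite cards0.
case: suffix_recurs => /=; first by rewrite mul1n card_right_forced.
by rewrite cards0.
Qed.

Lemma card_no_central_square : 1 < d ->
  k * d ^ k.-1 <=
    \sum_(i < k) #|[set t : k.-1.-tuple 'I_d | no_central_square ord0 k (extension i t)]|
    + 2 * (trunc_log 2 (size W)).+1 * d ^ k.-1.
Proof.
move=> d1; set l := (trunc_log 2 (size W)).+1.
have split_card (i : 'I_k) : d ^ k.-1 =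
    #|[set t : k.-1.-tuple 'I_d | no_central_square ord0 k (extension i t)]|
    + #|[set t : k.-1.-tuple 'I_d | ~~ no_central_square ord0 k (extension i t)]|.
  pose A := [set t : k.-1.-tuple 'I_d | no_central_square ord0 k (extension i t)].
  rewrite -[X in X ^ _]card_ord -card_tuple -(cardsC A); congr (_ + #|pred_of_set _|).
  by apply/setP => t; rewrite !inE.
have -> : k * d ^ k.-1 = \sum_(i < k) d ^ k.-1 by rewrite sum_nat_const card_ord.
rewrite (eq_bigr _ (fun i _ => split_card i)) big_split leq_add2l /=.
apply: (@leq_trans (\sum_(i < k) \sum_(g < k.-1) (prefix_recurs ord0 W (k - i) g.+1
    + suffix_recurs ord0 W (size W - (k - i)) g.+1) * d ^ (k.-1 - g.+1))).
  by apply: leq_sum => i _; apply: card_central_square.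
(* With g fixed, the doubling lemmas leave at most l values of i for prefixes and l for suffixes;
   the powers of d then sum geometrically. *)
rewrite exchange_big /=.
have le_l (g : 'I_k.-1) : \sum_(i < k) (prefix_recurs ord0 W (k - i) g.+1
    + suffix_recurs ord0 W (size W - (k - i)) g.+1) <= 2 * l.
  have sum_card (b : pred nat) : \sum_(i < k) (b i : nat) = #|[set i : 'I_k | b i]|.
    by rewrite -sum1dep_card [RHS]big_mkcond; apply: eq_bigr => i _; case: (b i).
  rewrite big_split mul2n -addnn.
  rewrite (sum_card (fun i => prefix_recurs ord0 W (k - i) g.+1)).
  rewrite (sum_card (fun i => suffix_recurs ord0 W (size W - (k - i)) g.+1)).
  apply: leq_add.
    apply: (@card_doubling_gaps _ _ (fun i => prefix_recurs ord0 W (k - i) g.+1) (subn k)).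
    - by move=> i i'; rewrite !inE; lia.
    - by move=> i lt_i; lia.
    - by move=> i i' _ _; apply: prefix_recurs_doubling.
  apply: (@card_doubling_gaps _ _
    (fun i => suffix_recurs ord0 W (size W - (k - i)) g.+1) (fun i => size W - (k - i))).
  - by move=> i i'; rewrite !inE; lia.
  - by move=> i lt_i; lia.
  - by move=> i i' _ _; apply: suffix_recurs_doubling.
apply: (@leq_trans (\sum_(g < k.-1) 2 * l * d ^ (k.-1 - g.+1))).
  by apply: leq_sum => g _; rewrite -big_distrl leq_mul2r le_l orbT.
by rewrite -big_distrr leq_mul2l sum_expn_leq ?orbT.
Qed.

End Extensions.

(** * Walks in the Kautz digraph as words *)

Section KautzWords.

Variables d D : nat.
Implicit Types (x y u v : kautz d D) (z s : seq 'I_d.+1).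

Local Notation nth0 := (nth (ord0 : 'I_d.+1)).
Local Notation kautz_word := (sorted (fun a b : 'I_d.+1 => a != b)).

Lemma size_word x : size (word x) = D.
Proof. exact: size_tuple. Qed.

Lemma sorted_word x : kautz_word (word x).
Proof. exact: (svalP x). Qed.

(** The vertex [x0] is only a default, returned when [s] is not the word of a vertex. *)
Definition to_kautz x0 s : kautz d D := odflt x0 [pick x : kautz d D | word x == s].

Lemma word_to_kautz x0 s : size s = D -> kautz_word s -> word (to_kautz x0 s) = s.
Proof.
move=> /eqP sz sw; rewrite /to_kautz; case: pickP => [x /eqP //|noW].
have sw' : kautz_word (Tuple sz) by [].
by have := noW (exist _ (Tuple sz) sw'); rewrite /word /= eqxx.
Qed.

Lemma size_edge_word u v : size (edge_word u v) = D.+1.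
Proof. by rewrite size_rcons size_word. Qed.

Lemma kautz_edge_word u v : 0 < D -> kautz_edge u v ->
  [/\ kautz_word (edge_word u v), take D (edge_word u v) = word u
    & drop 1 (edge_word u v) = word v].
Proof.
move=> D0 /existsP[c /andP[c_u /eqP v_c]].
have -> : edge_word u v = rcons (word u) c by rewrite /edge_word v_c last_rcons.
have := size_word u; have := sorted_word u; rewrite v_c.
case: (word u) c_u => [|a s] c_u su sz; first by move: D0; rewrite -sz.
split; last by rewrite drop1.
  by rewrite /= rcons_path; move: su c_u => /= ->; rewrite eq_sym => ->.
by rewrite -cats1 -sz take_size_cat.
Qed.

Lemma walk_overlap x (p : seq (kautz d D)) : path (@kautz_edge d D) x p -> size p <= D ->
  drop (size p) (word x) = take (D - size p) (word (last x p)).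
Proof.
elim: p x => [|y p IH] x /=; first by rewrite drop0 subn0 take_oversize ?size_word.
case/andP=> /existsP[c /andP[_ /eqP y_c]] xp lt_p.
(* The minimum lets the induction hypothesis apply to a prefix that is one letter longer, which is
   then cut back. *)
have -> : D - (size p).+1 = minn (D - (size p).+1) (D - size p) by lia.
rewrite take_min -IH //; last by lia.
have sz := size_word x; rewrite y_c -drop1 drop_rcons; last by rewrite size_drop sz; lia.
by rewrite drop_drop addn1 -cats1 take_size_cat // size_drop sz.
Qed.

Section Walk.

Variables (x0 : kautz d D) (k : nat) (z : seq 'I_d.+1).
Hypotheses (sz : size z = D + k) (zK : kautz_word z).

Definition window t := to_kautz x0 (take D (drop t z)).

Lemma word_window t : t <= k -> word (window t) = take D (drop t z).
Proof.
move=> le_t; apply: word_to_kautz; last by apply: take_sorted; apply: drop_sorted.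
by rewrite size_takel // size_drop; lia.
Qed.

Hypotheses (k0 : 0 < k) (le_kD : k <= D).

Lemma window_edge t : t < k -> kautz_edge (window t) (window t.+1).
Proof.
move=> lt_t; have zD : t + D < size z by lia.
apply/existsP; exists (nth0 z (t + D)); rewrite !word_window //; last exact: ltnW.
have sw : size (take D (drop t z)) = D by rewrite size_takel // size_drop; lia.
apply/andP; split.
  rewrite (last_nth ord0) sw; case: D k0 le_kD zD sw => [|D']; first by lia.
  move=> _ _ zD sw; rewrite /= nth_take // nth_drop eq_sym addnS.
  by move/sortedP: zK => /(_ ord0); apply; rewrite -addnS.
apply/eqP; apply: (@eq_from_nth _ ord0).
  by rewrite size_rcons size_behead sw size_takel ?size_drop; lia.
move=> s; rewrite size_takel; last by rewrite size_drop; lia.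
move=> lt_s; rewrite nth_take // nth_drop nth_rcons size_behead sw nth_behead.
case: ltnP => [lt_sD|le_sD].
  by rewrite nth_take ?nth_drop; [congr nth|]; lia.
by rewrite ifT; [congr nth|]; lia.
Qed.

Definition window_walk := [seq window t | t <- iota 1 k].

Lemma path_window_walk : path (@kautz_edge d D) (window 0) window_walk.
Proof.
have path_m m t : t + m <= k ->
    path (@kautz_edge d D) (window t) [seq window t' | t' <- iota t.+1 m].
  elim: m t => //= m IH t le_m; rewrite window_edge ?IH //; lia.
by apply: path_m.
Qed.

Lemma last_window_walk : last (window 0) window_walk = window k.
Proof.
rewrite /window_walk; have -> : k = k.-1 + 1 by lia.
by rewrite iotaD map_cat last_cat /= add1n addn1.
Qed.

(** A walk of length j < k makes the last D - j letters of the source a prefix of the target. Since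
    k <= D, the first k - j of them give a square centred at k. *)
Lemma leq_walk_window (q : seq (kautz d D)) : no_central_square ord0 k z ->
  path (@kautz_edge d D) (window 0) q -> last (window 0) q = window k -> k <= size q.
Proof.
move=> ncs wq lq; rewrite leqNgt; apply/negP => lt_q.
have le_q : size q <= D by lia.
have := walk_overlap wq le_q.
rewrite lq !word_window // drop0 take_takel ?leq_subr // => ov.
(* The half-length is k - [size q]; the predecessor appears because ordinals index half-lengths from
   1. *)
have lt_p : (k - size q).-1 < k by lia.
have /negP[] := forallP ncs (Ordinal lt_p).
apply/forallP => -[s /= lt_s]; apply/eqP.
have := congr1 (fun w => nth0 w s) ov.
rewrite nth_drop !nth_take ?nth_drop; try lia.
by move=> <-; congr nth; lia.
Qed.

Lemma geodesic_window_walk : no_central_square ord0 k z ->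
  geodesic (@kautz_edge d D) (window 0) (window k) window_walk.
Proof.
move=> ncs; split; [exact: path_window_walk | exact: last_window_walk |].
by move=> q; rewrite size_map size_iota; apply: leq_walk_window.
Qed.

End Walk.

End KautzWords.

(** * Geodesics through a fixed edge *)

Section EdgeExtensions.

Variables (d D : nat) (u v : kautz d D).
Hypotheses (D0 : 0 < D) (euv : kautz_edge u v) (csf : circular_square_free (edge_word u v)).

Let W := edge_word u v.
Let ext i (t : seq 'I_d) := extension W i t.

Let sW : size W = D.+1. Proof. exact: size_edge_word. Qed.

Let size_ext k i (t : k.-1.-tuple 'I_d) : 0 < k -> size (ext i t) = D + k.
Proof. by move=> k0; rewrite size_extension sW size_tuple; lia. Qed.

Lemma extension_kautz i t : sorted (fun a b => a != b) (ext i t).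
Proof.
have W_K : sorted (fun a b => a != b) W by case: (kautz_edge_word D0 euv).
rewrite /ext /extension; case: W W_K sW => // a w /= aw _.
rewrite sorted_cat_cons cat_path aw path_walk_from !andbT.
rewrite -rev_cons rev_sorted /=.
by rewrite (@eq_path _ _ (fun b c => b != c)) ?path_walk_from // => b c; rewrite eq_sym.
Qed.

Lemma edge_window k i t : i < k -> size t = k.-1 ->
  window u (ext i t) i = u /\ window u (ext i t) i.+1 = v.
Proof.
move=> lt_i st; have [_ Wu Wv] := kautz_edge_word D0 euv.
have le_i : i <= size t by lia.
have sz : size (ext i t) = D + k by rewrite size_extension sW; lia.
have zK := extension_kautz i t.
have k0 : 0 < k by lia.
split; do 2!apply: val_inj; rewrite -[LHS]/(word _) -[RHS]/(word _) (word_window u sz zK) //;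
  try lia.
  rewrite -Wu; apply: (@eq_from_nth _ ord0).
    by rewrite !size_takel ?size_drop ?sz ?sW //; lia.
  move=> s; rewrite size_takel; last by rewrite size_drop; lia.
  by move=> lt_s; rewrite !nth_take // nth_drop nth_extension_mid // sW; lia.
rewrite -Wv; apply: (@eq_from_nth _ ord0).
  by rewrite size_takel !size_drop ?sz ?sW //; lia.
move=> s; rewrite size_takel; last by rewrite size_drop; lia.
move=> lt_s; rewrite nth_take // !nth_drop addSnnS nth_extension_mid //.
by rewrite sW; lia.
Qed.

Definition extension_ends k (it : 'I_k * k.-1.-tuple 'I_d) : kautz d D * kautz d D :=
  (window u (ext it.1 it.2) 0, window u (ext it.1 it.2) k).

Definition geodesic_extensions k : {set 'I_k * k.-1.-tuple 'I_d} :=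
  [set it : 'I_k * k.-1.-tuple 'I_d | no_central_square ord0 k (ext it.1 it.2)].

Lemma extension_ends_cong k it : k <= D -> it \in geodesic_extensions k ->
  extension_ends it \in [set xy : kautz d D * kautz d D |
    (xy.1 != xy.2) && `[< geodesic_uses (@kautz_edge d D) u v xy.1 xy.2 >]].
Proof.
move=> le_k; case: it => i t; rewrite inE /= => ncs; rewrite inE /=.
have lt_i := ltn_ord i; have k0 : 0 < k by lia.
have geo := geodesic_window_walk u (size_ext i t k0) (extension_kautz i t) k0 le_k ncs.
apply/andP; split.
  (* If the ends coincided, the empty walk would be shorter than the geodesic. *)
  apply/negP => /eqP e; case: geo => _ _ /(_ [::] isT e).
  by rewrite size_map size_iota leqNgt k0.
apply/asboolP; exists (window_walk u k (ext i t)) => //.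
have [eu ev] := edge_window lt_i (size_tuple t).
rewrite /window_walk.
have -> : window u (ext i t) 0 :: [seq window u (ext i t) t0 | t0 <- iota 1 k]
   = [seq window u (ext i t) t0 | t0 <- iota 0 k.+1] by [].
(* This isolates the vertices number i and i + 1 of the walk, which are [u] and [v]. *)
have -> : k.+1 = i + (2 + (k - i.+1)) by lia.
rewrite !iotaD !map_cat /= add0n eu ev.
by apply/infixP; eexists; eexists.
Qed.

(** Two occurrences of [W] at positions i < i' <= D of one word overlap and give [W] the period i' -
    i. Once i is known, both codes can be read off. *)
Lemma extension_inj i i' t t' : i <= size t -> i' <= size t' -> size t = size t' ->
  size t < D -> ext i t = ext i' t' -> i = i' /\ t = t'.
Proof.
move=> le_i le_i' st lt_t e.
have no_lt j j' s s' : j <= size s -> j' <= size s' -> j' <= D ->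
    ext j s = ext j' s' -> ~ j < j'.
  move=> le_j le_j' le_jD e' lt_j.
  apply: (@circular_square_free_aperiodic _ ord0 W (j' - j) csf).
    by rewrite sW; lia.
  move=> r lt_r; rewrite sW in lt_r.
  rewrite -(@nth_extension_mid _ W j' s' r) //; last by rewrite sW; lia.
  rewrite -/(ext j' s') -e' -(@nth_extension_mid _ W j s) //; last by rewrite sW; lia.
  by congr nth; lia.
have ei : i = i'.
  have le_iD : i <= D by lia.
  have le_iD' : i' <= D by lia.
  case: (ltngtP i i') => //; [move=> lt_i | move=> lt_i].
    by case: (no_lt i i' t t').
  by case: (no_lt i' i t' t).
split=> //; subst i'; move/eqP: e; rewrite /ext /extension eqseq_cat; last first.
  by rewrite !size_rev !size_walk_from !size_takel.
rewrite eqseq_cat // eqxx /= => /andP[/eqP/(can_inj revK)/walk_from_inj e1].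
by move=> /eqP/walk_from_inj e2; rewrite -(cat_take_drop i t) e1 e2 cat_take_drop.
Qed.

(* A pair joined by geodesics of lengths [k < k'] would make the word of the
   longer one carry a square of half-length [k' - k] centred at [k']. *)
Lemma extension_ends_inj k k' (it : 'I_k * k.-1.-tuple 'I_d)
    (it' : 'I_k' * k'.-1.-tuple 'I_d) : k <= k' <= D ->
  it' \in geodesic_extensions k' -> extension_ends it = extension_ends it' ->
  k = k' /\ ext it.1 it.2 = ext it'.1 it'.2.
Proof.
case: it it' => [i t] [i' t'] /andP[le_k le_k']; rewrite inE /= => ncs.
have k0 : 0 < k by have := ltn_ord i; lia.
have k'0 : 0 < k' by lia.
case=> /(congr1 (@word d D)) ex /(congr1 (@word d D)) ey; move: ex ey.
have sz := size_ext i t k0; have sz' := size_ext i' t' k'0.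
have zK := extension_kautz i t; have zK' := extension_kautz i' t'.
rewrite !(word_window u sz zK) // !(word_window u sz' zK') // !drop0.
rewrite [take D (drop k _)]take_oversize; last by rewrite size_drop sz; lia.
rewrite [take D (drop k' _)]take_oversize; last by rewrite size_drop sz'; lia.
move: (ext i t) (ext i' t') sz sz' ncs {zK zK'} => z z' sz sz' ncs ex ey.
have ek : k = k'.
  apply/eqP; rewrite eqn_leq le_k leqNgt; apply/negP => lt_k.
  have lt_p : (k' - k).-1 < k' by lia.
  have /negP[] := forallP ncs (Ordinal lt_p).
  apply/forallP => -[s /= lt_s]; apply/eqP.
  have -> : k' - (k' - k).-1.+1 + s = k + s by lia.
  have lt_sD : k + s < D by lia.
  rewrite -(nth_take ord0 lt_sD) -ex nth_take // -nth_drop ey nth_drop //.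
split=> //; subst k'.
(* For equal lengths, the first and the last D letters cover the whole word because k <= D. *)
rewrite -(cat_take_drop D z) -(cat_take_drop D z') ex; congr (_ ++ _).
by rewrite -(subnK le_k') -!drop_drop ey.
Qed.

(** The pair of ends determines the word, and the word determines i and [t], so pairs are as
    numerous as codes. *)
Lemma card_extension_ends k : 1 < d -> 0 < k <= D ->
  k * d ^ k.-1 <= #|@extension_ends k @: geodesic_extensions k|
                  + 2 * (trunc_log 2 D.+1).+1 * d ^ k.-1.
Proof.
move=> d1 /andP[k0 le_k].
have lt_kW : k < size W by rewrite sW.
have := card_no_central_square k0 lt_kW csf d1; rewrite sW => le_card.
rewrite card_in_imset; last first.
  move=> [i t] [i' t'] _ it' /(extension_ends_inj _ it')[|_ /=]; first by rewrite leqnn.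
  have lt_i := ltn_ord i; have lt_i' := ltn_ord i'.
  case/extension_inj; rewrite ?size_tuple //; try lia.
  by move=> /val_inj-> /val_inj->.
apply: leq_trans le_card _; rewrite leq_add2r.
rewrite -sum1dep_card -(pair_big_dep xpredT
  (fun (i : 'I_k) (t : k.-1.-tuple 'I_d) => no_central_square ord0 k (ext i t))
  (fun _ _ => 1)) /=.
by apply: leq_sum => i _; rewrite sum1dep_card.
Qed.

Lemma disjoint_extension_ends k k' : k < k' <= D ->
  [disjoint @extension_ends k @: geodesic_extensions k
          & @extension_ends k' @: geodesic_extensions k'].
Proof.
move=> /andP[lt_k le_k']; apply/pred0P => xy; apply/negP => /andP[].
case/imsetP => it _ -> /imsetP[it' git'].
case/(extension_ends_inj _ git'); first by rewrite (ltnW lt_k).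
by move=> ek; rewrite ek ltnn in lt_k.
Qed.

Lemma cong_geq_three_lengths k1 k2 k3 : k1 < k2 < k3 -> k3 <= D ->
  #|@extension_ends k1 @: geodesic_extensions k1|
  + #|@extension_ends k2 @: geodesic_extensions k2|
  + #|@extension_ends k3 @: geodesic_extensions k3| <= cong (@kautz_edge d D) u v.
Proof.
move=> /andP[lt12 lt23] le3.
set T1 := imset _ _; set T2 := imset _ _; set T3 := imset _ _.
have dis12 : [disjoint T1 & T2] by apply: disjoint_extension_ends; lia.
have dis13 : [disjoint T1 & T3] by apply: disjoint_extension_ends; lia.
have dis23 : [disjoint T2 & T3] by apply: disjoint_extension_ends; lia.
have /eqP <- : #|T1 :|: T2| == #|T1| + #|T2| by rewrite (leq_card_setU T1 T2).2.
have /eqP <- : #|T1 :|: T2 :|: T3| == #|T1 :|: T2| + #|T3|.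
  by rewrite (leq_card_setU (T1 :|: T2) T3).2 -setI_eq0 setIUl setU_eq0 !setI_eq0 dis13.
apply: subset_leq_card; rewrite !subUset -andbA.
by apply/and3P; split; apply/subsetP => _ /imsetP[it git ->];
  apply: extension_ends_cong => //; lia.
Qed.

End EdgeExtensions.

(** * Asymptotic comparison with the threshold *)

Lemma log_eventually_small M : exists D0, forall D, D0 <= D ->
  2 * (trunc_log 2 D.+1).+1 * M + 2 < D.
Proof.
(* With r the logarithm and h = r./2, D + 1 >= 2^r >= (2^h)^2 >= (h + 1)^2, and h >= 4M + 4 makes
   this exceed the left side, which is linear in h. *)
exists (2 ^ (8 * M + 8)) => D leD.
have := @trunc_log_bounds 2 D.+1 isT isT.
have : 8 * M + 8 <= trunc_log 2 D.+1 by rewrite trunc_log_max //; apply: leqW.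
move: (trunc_log 2 D.+1) => r le_r /andP[le_D _].
have [h rh] : {h | r = h + h + odd r}.
  by exists r./2; rewrite addnn addnC odd_double_half.
have lt_h := ltn_expl h (ltnSn 1).
have : 2 ^ h * 2 ^ h <= 2 ^ r by rewrite rh !expnD leq_pmulr // expn_gt0.
have := leq_b1 (odd r).
move: (2 ^ h) (2 ^ r) lt_h le_D => a b; nia.
Qed.

Theorem corollary6p8 (d : nat) (hd : 3 <= d) :
  exists D0 : nat, forall D : nat, D0 <= D ->
    forall u v : kautz d D, kautz_edge u v ->
      ternary (edge_word u v) ->
      circular_square_free (edge_word u v) ->
      cong (@kautz_edge d D) u v > tau d D.
Proof.
have d1 : 1 < d by apply: leq_trans hd.
(* The losses c d^(D-1), c d^(D-2) and c d^(D-3) add up to c (d^2 + d + 1) d^(D-3). *)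
have [D0 D0P] := log_eventually_small (d * d + d + 1).
exists D0 => D /D0P ltD u v euv _ csf.
have [n Dn] : {n | D = n.+3} by exists (D - 3); lia.
subst D; set c := 2 * _ in ltD.
have D_gt0 : 0 < n.+3 by [].
have card_k := card_extension_ends D_gt0 euv csf d1.
have := card_k n.+1 (leqW (leqnSn n.+1)).
have := card_k n.+2 (leqnSn n.+2).
have := card_k n.+3 (leqnn n.+3); rewrite -/c /=.
have := cong_geq_three_lengths D_gt0 euv (k1 := n.+1) (k2 := n.+2) (k3 := n.+3).
rewrite !ltnS !leqnn => /(_ isT isT).
rewrite /tau subn1 subSS subn1 /= !expnS.
have q0 : 0 < d ^ n by rewrite expn_gt0 ltnW.
(* Before losses, lengths D and D - 1 contribute exactly [tau d D]; length D - 2 = n + 1 contributes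
   the surplus on the right, which exceeds all losses. *)
have : c * (d * d + d + 1) * d ^ n < n.+1 * d ^ n by rewrite ltn_pmul2r //; lia.
move: (d ^ n) {card_k} => q lt_q le_cong le3 le2 le1.
lia.
Qed.
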